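(* Let $E$ be a finitely generated Hilbert $C^*$-module over a commutative $C^*$-algebra $\mathcal{A}$. Then every closed semiregular operator $T$ in $E$ is regular.
   Context: $C^*$-algebras are not assumed unital. A Hilbert $C^*$-module $E$ over $\mathcal{A}$ is a right $\mathcal{A}$-module with an $\mathcal{A}$-valued inner product $\langle\cdot,\cdot\rangle$ (conjugate linear in the first, linear in the second variable), complete in the norm $\|x\|=\|\langle x,x\rangle\|^{1/2}$. Finitely generated means that there are $f_1,\dots,f_N\in E$ generating $E$ over $\mathcal{A}$, i.e. every element of $E$ is of the form $\sum_j f_j\varphi_j$ with $\varphi_j\in\mathcal{A}$. A semiregular operator in $E$ is an operator $T:\mathrm{dom}(T)\to E$ defined on a dense $\mathcal{A}$-submodule $\mathrm{dom}(T)\subset E$ whose adjoint $T^*$ is densely defined; here $y\in\mathrm{dom}(T^* )$ iff there is $z=T^*y\in E$ with $\langle Tx,y\rangle=\langle x,z\rangle$ for all $x\in\mathrm{dom}(T)$. Such a $T$ is automatically $\mathcal{A}$-linear and closable. A closed semiregular operator $T$ is called regular if $I+T^*T$ has dense range (it is then invertible). *)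

(* Defs.v *)
From HB Require Import structures.
From mathcomp Require Import all_boot all_order all_algebra.
From mathcomp Require Import complex.
From mathcomp Require Import all_classical all_reals all_analysis.

Set Implicit Arguments.
Unset Strict Implicit.
Unset Printing Implicit Defensive.

Import Order.TTheory GRing.Theory Num.Theory.
Import numFieldNormedType.Exports.

Local Open Scope classical_set_scope.
Local Open Scope ring_scope.

(* MathComp rings are unital, so the product of a (possibly non-unital)
   C*-algebra is a separate operation on a complex Banach space. *)
HB.mixin Record CompleteNormedModule_isCStarAlgebra (R : realType) A
    of CompleteNormedModule R[i] A := {
  cmul : A -> A -> A;
  cstar : A -> A;
  cmulA : associative cmul;
  cmulDl : forall a b c : A, cmul (a + b) c = cmul a c + cmul b c;
  cmulDr : forall a b c : A, cmul a (b + c) = cmul a b + cmul a c;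
  cmulZl : forall (l : R[i]) (a b : A), cmul (l *: a) b = l *: cmul a b;
  cmulZr : forall (l : R[i]) (a b : A), cmul a (l *: b) = l *: cmul a b;
  cstarK : involutive cstar;
  cstarD : forall a b : A, cstar (a + b) = cstar a + cstar b;
  cstarZ : forall (l : R[i]) (a : A), cstar (l *: a) = l^* *: cstar a;
  cstarM : forall a b : A, cstar (cmul a b) = cmul (cstar b) (cstar a);
  cnormM : forall a b : A, `|cmul a b| <= `|a| * `|b|;
  cnorm_star : forall a : A, `|cmul (cstar a) a| = `|a| ^+ 2
}.

#[short(type="cstarAlgType")]
HB.structure Definition CStarAlgebra (R : realType) :=
  {A of CompleteNormedModule_isCStarAlgebra R A & CompleteNormedModule R[i] A}.

Definition cpositive (R : realType) (A : cstarAlgType R) (a : A) : Prop :=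
  exists b : A, a = cmul (cstar b) b.

(* The norm of E is part of the inherited Banach space structure; [inner_norm]
   identifies it with the one given by the inner product, which also makes the
   inner product definite. Conjugate linearity in the first variable follows
   from linearity in the second one and [inner_star]. *)
HB.mixin Record CompleteNormedModule_isHilbertModule (R : realType)
    (A : cstarAlgType R) E of CompleteNormedModule R[i] E := {
  ract : E -> A -> E;
  inner : E -> E -> A;
  ractDl : forall (x y : E) (a : A), ract (x + y) a = ract x a + ract y a;
  ractDr : forall (x : E) (a b : A), ract x (a + b) = ract x a + ract x b;
  ractM : forall (x : E) (a b : A), ract x (cmul a b) = ract (ract x a) b;
  ractZl : forall (l : R[i]) (x : E) (a : A), ract (l *: x) a = l *: ract x a;
  ractZr : forall (l : R[i]) (x : E) (a : A), ract x (l *: a) = l *: ract x a;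
  innerDr : forall x y z : E, inner x (y + z) = inner x y + inner x z;
  innerZr : forall (l : R[i]) (x y : E), inner x (l *: y) = l *: inner x y;
  inner_ract : forall (x y : E) (a : A), inner x (ract y a) = cmul (inner x y) a;
  inner_star : forall x y : E, cstar (inner x y) = inner y x;
  inner_pos : forall x : E, cpositive (inner x x);
  inner_norm : forall x : E, `|x| = sqrtC `|inner x x|
}.

#[short(type="hilbertModType")]
HB.structure Definition HilbertModule (R : realType) (A : cstarAlgType R) :=
  {E of CompleteNormedModule_isHilbertModule R A E & CompleteNormedModule R[i] E}.

Section Operators.
Context {R : realType} {A : cstarAlgType R} {E : hilbertModType A}.

Definition finitely_generated : Prop :=
  exists (N : nat) (f : 'I_N -> E),
    forall x : E, exists phi : 'I_N -> A, x = \sum_(j < N) ract (f j) (phi j).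

Definition is_submodule (D : set E) : Prop :=
  [/\ D 0,
      forall x y : E, D x -> D y -> D (x + y),
      forall (l : R[i]) (x : E), D x -> D (l *: x)
    & forall (x : E) (a : A), D x -> D (ract x a)].

(* The values of [opfun] outside [opdom] are irrelevant. *)
Record operator := Operator { opdom : set E ; opfun :> E -> E }.

Definition adjoint_rel (T : operator) (y z : E) : Prop :=
  forall x : E, opdom T x -> inner (T x) y = inner x z.

(* When [opdom T] is dense the witness z is unique, so [xget] picks T^* y. *)
Definition adjoint (T : operator) : operator :=
  {| opdom := [set y | exists z, adjoint_rel T y z];
     opfun := fun y => xget 0 [set z | adjoint_rel T y z] |}.

(* Linearity of T on its domain is a consequence of these conditions. *)
Definition semiregular (T : operator) : Prop :=
  [/\ is_submodule (opdom T), dense (opdom T) & dense (opdom (adjoint T))].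

Definition graph (T : operator) : set (E * E) :=
  [set p | opdom T p.1 /\ p.2 = T p.1].

Definition closed_operator (T : operator) : Prop := closed (graph T).

Definition id_plus_adjoint_comp (T : operator) : operator :=
  {| opdom := [set x | opdom T x /\ opdom (adjoint T) (T x)];
     opfun := fun x => x + adjoint T (T x) |}.

Definition regular (T : operator) : Prop :=
  [/\ closed_operator T, semiregular T
    & dense (id_plus_adjoint_comp T @` opdom (id_plus_adjoint_comp T))].

End Operators.

Arguments finitely_generated {R A} E.
Arguments operator {R A} E.

(* Main.v *)
Require Import Defs.
From mathcomp Require Import all_boot all_order all_algebra.
From mathcomp Require Import complex.
From mathcomp Require Import all_classical all_reals all_analysis.
From mathcomp Require Import ring lra.

Set Implicit Arguments.
Unset Strict Implicit.
Unset Printing Implicit Defensive.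

Import Order.TTheory GRing.Theory Num.Theory.
Import numFieldNormedType.Exports.
Local Open Scope classical_set_scope.
Local Open Scope ring_scope.
Local Open Scope complex_scope.

(** Over a finitely generated module a closed semiregular operator is
    everywhere defined and bounded, so that regularity becomes a statement
    about a bounded adjointable operator.

    Why the domains are everything.  Surjectivity of the map
    phi |-> sum_j f_j phi_j from A^N onto E gives, by an open mapping argument,
    solutions phi of size at most C|x|, up to an error |x|/4
    ([finitely_generated_approx]).  The same estimate, with a
    slightly larger error, survives when the generators f_j are replaced by
    close elements g_j, and successive approximation then turns it into an
    exact representation ([combination_exact]).  Hence every dense subset of E
    contains finitely many generators of E, and a dense submodule is the whole
    of E ([dense_submodule_full]).  This applies to dom(T) and to dom(T^* ).
    An everywhere defined operator with an everywhere defined adjoint is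
    A-linear, hence bounded because it is determined by its values on the
    generators.

    Why I + T^*T has dense range.  By the method of continuity it is enough
    that x + tT^*Tx has norm at least c|x| with c > 0 independent of t >= 0.
    Pairing with x gives <x,x> + t<Tx,Tx>, so this reduces to |p| <= |p + q|
    for positive p and q in A.  The C^*-identity gives |z + iuz| = |z - iuz|
    for self-adjoint u, therefore u^2 is accretive, i.e. |z| <= |z + t u^2 z| for all t >= 0.  Accretivity is
    stable under sums, and in a commutative algebra a^*a is a sum of two squares
    of self-adjoint elements, so all positive elements are accretive.
    Finally, if |p + q| < |p| = 1, accretivity of q bounds
    1 - p from below, whereas the elements
    (1 + p)(1 + p^2)(1 + p^4)...(1 + p^(2^k))p have norm at least 2^k and are
    mapped by 1 - p to elements of norm at most 2
    ([le_rnorm_accretiveD]). *)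

(** * Real-valued norms over the complex numbers *)

Section RealNorm.
Context {R : realType} {V : normedModType R[i]}.
Implicit Types x y : V.

(** The norm takes its values in [R[i]], whose order is partial; its real part
    allows arithmetic in the ordered field [R]. *)
Definition rnorm (x : V) : R := complex.Re `|x|.

Lemma rnormE x : `|x| = (rnorm x)%:C.
Proof. by rewrite /rnorm RRe_real // normr_real. Qed.

Lemma rnorm_ge0 x : 0 <= rnorm x.
Proof. by rewrite -ler0c -rnormE normr_ge0. Qed.

Lemma rnorm0 : rnorm (0 : V) = 0.
Proof. by apply: complexI; rewrite -rnormE normr0. Qed.

Lemma rnorm_eq0 x : rnorm x = 0 -> x = 0.
Proof. by move=> x0; apply/normr0_eq0; rewrite rnormE x0. Qed.

Lemma rnormD x y : rnorm (x + y) <= rnorm x + rnorm y.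
Proof. by rewrite -lecR rmorphD /= -!rnormE ler_normD. Qed.

Lemma rnormN x : rnorm (- x) = rnorm x.
Proof. by rewrite /rnorm normrN. Qed.

Lemma rnormB x y : rnorm (x - y) <= rnorm x + rnorm y.
Proof. by rewrite -(rnormN y) rnormD. Qed.

Lemma rnorm_distC x y : rnorm (x - y) = rnorm (y - x).
Proof. by rewrite -rnormN opprB. Qed.

Lemma rnorm_sum (I : Type) (s : seq I) (F : I -> V) :
  rnorm (\sum_(i <- s) F i) <= \sum_(i <- s) rnorm (F i).
Proof.
elim/big_rec2: _ => [|i r x _ xr]; first by rewrite rnorm0.
by rewrite (le_trans (rnormD _ _)) // lerD2l.
Qed.

Lemma rnormZ (t : R) x : rnorm (t%:C *: x) = `|t| * rnorm x.
Proof.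
apply: complexI; rewrite -rnormE normrZ normc_def /= expr0n addr0 sqrtr_sqr.
by rewrite rmorphM /= -rnormE.
Qed.

Lemma rnormZi x : rnorm ('i *: x) = rnorm x.
Proof.
by rewrite /rnorm normrZ normc_def /= expr0n add0r expr1n sqrtr1 mul1r.
Qed.

Lemma dense_approx (D : set V) :
  dense D <-> forall x (e : R), 0 < e -> exists2 y, D y & rnorm (x - y) < e.
Proof.
split=> [Dd x e e0|Dd O [x Ox] Oo].
- have /(Dd _) : ball x e%:C !=set0 by exists x; apply: ballxx; rewrite ltcR.
  case; first exact: ball_open.
  by move=> y []; rewrite -ball_normE /= rnormE ltcR => xy Dy; exists y.
- have /nbhs_normP[e /= e0 eO] : nbhs x O by exact: open_nbhs_nbhs.
  have eR : e = (complex.Re e)%:C by rewrite RRe_real // gtr0_real.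
  have [|y Dy xy] := Dd x (complex.Re e); first by rewrite -ltcR -eR.
  by exists y; split=> //; apply: eO; rewrite /= rnormE eR ltcR.
Qed.

End RealNorm.

Lemma geometric_small (R : realType) (c r e : R) :
  0 <= r < 1 -> 0 < e -> exists n, c * r ^+ n < e.
Proof.
move=> /andP[r0 r1] e0.
have /cvgrPdist_lt/(_ _ e0)[n _ /(_ n (leqnn _))] :
    geometric c r @ \oo --> (0 : R).
  by apply: cvg_geometric; rewrite ger0_norm.
by rewrite /= sub0r normrN => /(le_lt_trans (ler_norm _)) ?; exists n.
Qed.

Lemma rnorm_small0 (R : realType) (V : normedModType R[i]) (x : V) (c r : R) :
  0 <= r < 1 -> (forall n, rnorm x <= c * r ^+ n) -> x = 0.
Proof.
move=> r01 xc; apply: rnorm_eq0; apply/eqP; rewrite eq_le rnorm_ge0 andbT.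
rewrite leNgt; apply/negP => /(geometric_small c r01)[n].
by rewrite ltNge xc.
Qed.

(** The only use of completeness: the error after [n] terms is the tail of the
    geometric series. *)
Lemma geometric_series_cvg (R : realType) (V : completeNormedModType R[i])
    (u : nat -> V) (c r : R) :
  0 <= r < 1 -> (forall k, rnorm (u k) <= c * r ^+ k) ->
  exists s, forall n, rnorm (s - \sum_(k < n) u k) <= c / (1 - r) * r ^+ n.
Proof.
move=> r01 uc; have /andP[r0 r1] := r01.
have c0 : 0 <= c.
  by have := uc 0; rewrite expr0 mulr1; apply: le_trans (rnorm_ge0 _).
pose S n := \sum_(k < n) u k.
have Sdist n m :
    rnorm (S (n + m)%N - S n) <= c / (1 - r) * (r ^+ n - r ^+ (n + m)).
  elim: m => [|m IH]; first by rewrite addn0 !subrr mulr0 rnorm0.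
  rewrite addnS {1}/S big_ord_recr /= -/(S _) addrAC.
  apply: (le_trans (rnormD _ _)); apply: (le_trans (lerD IH (uc _))).
  rewrite exprS le_eqVlt; apply/orP; left; apply/eqP; field.
  by rewrite subr_eq0 gt_eqF.
have c'0 : 0 <= c / (1 - r) by rewrite divr_ge0 // subr_ge0 ltW.
have Sle n m : (n <= m)%N -> rnorm (S m - S n) <= c / (1 - r) * r ^+ n.
  move=> /subnKC <-; apply: (le_trans (Sdist _ _)).
  by rewrite ler_wpM2l // gerBl exprn_ge0.
have : cvg (S @ \oo).
  apply: cauchy_cvg; apply: cauchy_exP => e e0.
  have eR : e = (complex.Re e)%:C by rewrite RRe_real // gtr0_real.
  have [|n ne] := @geometric_small _ (c / (1 - r)) r (complex.Re e) r01.
    by rewrite -ltcR -eR.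
  exists (S n); exists n => // m /= nm.
  rewrite -ball_normE /= rnormE eR ltcR rnorm_distC.
  exact: le_lt_trans (Sle _ _ nm) ne.
case/cvg_ex => s Ss; exists s => n; apply/ler_addgt0Pr => e e0.
have /cvgrPdist_lt/(_ e%:C) := Ss; rewrite ltcR => /(_ e0)[k _ kS].
pose m := maxn n k.
have := kS m (leq_maxr _ _); rewrite /= rnormE ltcR => sm.
rewrite -(subrK (S m) s) -addrA addrC; apply: (le_trans (rnormD _ _)).
by rewrite lerD ?(ltW sm) // Sle // leq_maxl.
Qed.

(** * Bounded solutions of a surjective equation *)

(** Open mapping principle, with [P c x] read as: [x] lies in [c] times a fixed
    convex balanced set.  It is proved by a gliding hump: if every [c] had an
    [x c] in the unit ball badly approximated by [P c], a sum [s] of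
    rapidly decreasing multiples of such vectors would lie in some [P d], and
    isolating its [n]-th term would approximate that very vector from a set
    [P c] which it was chosen to avoid. *)
Lemma cover_approximation (R : realType) (V : completeNormedModType R[i])
    (P : R -> V -> Prop) :
  (forall c d x, c <= d -> P c x -> P d x) ->
  (forall c d x y, P c x -> P d y -> P (c + d) (x + y)) ->
  (forall c (t : R) x, P c x -> P (`|t| * c) (t%:C *: x)) ->
  (forall x, exists c, P c x) ->
  exists c, forall x, rnorm x <= 1 -> exists2 y, P c y & rnorm (x - y) <= 4^-1.
Proof.
move=> Ple PD PZ Pcover; apply: contrapT => noc.
have /choice[x xP] : forall c, exists x : V, rnorm x <= 1 /\
    forall y, P c y -> 4^-1 < rnorm (x - y).
  move=> c; apply: contrapT => nox; apply: noc; exists c => x x1.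
  apply: contrapT => noy; apply: nox; exists x; split=> // y Py.
  by rewrite ltNge; apply/negP => xy; apply: noy; exists y.
have [g gP] := choice Pcover.
pose sz (x : V) : R := `|g x|.
have szP y : P (sz y) y by apply: Ple (gP y); rewrite /sz ler_norm.
(* k n bounds the size of the sum of the humps before the n-th, and C n (k n)
   that of y below, the rescaled difference isolating the n-th hump *)
pose C n k : R := 8 ^+ n * (n%:R + k).
pose k := fix k n : R := if n is m.+1 then k m + sz (x (C m (k m))) else 0.
pose h n := x (C n (k n)).
pose u n := (8^-1 ^+ n)%:C *: h n.
have r0 n : 0 <= (8^-1 : R) ^+ n by rewrite exprn_ge0 // invr_ge0.
have r1 n : (8^-1 : R) ^+ n <= 1.
  by rewrite exprn_ile1 ?invr_ge0 // invf_le1 // ler1n.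
have r01 : 0 <= (8^-1 : R) < 1 by rewrite invr_ge0 ler0n invf_lt1 // ltr1n.
have u1 n : rnorm (u n) <= 1 * 8^-1 ^+ n.
  rewrite rnormZ ger0_norm // mul1r ler_piMr //; exact: (xP _).1.
have P00 : P 0 0 by have := PZ _ 0 _ (gP 0); rewrite normr0 mul0r scale0r.
have partP n : P (k n) (\sum_(j < n) u j).
  elim: n => [|n IH]; first by rewrite big_ord0.
  rewrite big_ord_recr /=; apply: PD => //.
  apply: Ple (PZ _ _ _ (szP (h n))).
  by rewrite ger0_norm // ler_piMl // /sz.
have [s sP] := geometric_series_cvg r01 u1.
pose n := (Num.truncn (sz s)).+1.
have sn : sz s <= n%:R by apply/ltW/truncnS_gt.
pose y := (8 ^+ n)%:C *: (s - \sum_(j < n) u j).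
have Py : P (C n (k n)) y.
  rewrite /C -[X in X * (_ + _)](ger0_norm (exprn_ge0 n (ler0n R 8))).
  apply: (PZ); apply: (PD); first exact: Ple sn (szP s).
  rewrite -scaleN1r -(rmorphN1 (real_complex R)).
  by apply: Ple (PZ _ (-1) _ (partP n)); rewrite normrN1 mul1r.
have := (xP (C n (k n))).2 _ Py; rewrite -/(h n) ltNge => /negP; apply.
(* rescaled by 8^n, the humps after the n-th add up to at most
   1/8 + 1/64 + ... = 1/7 < 1/4 *)
have -> : h n - y = - ((8 ^+ n)%:C *: (s - \sum_(j < n.+1) u j)).
  rewrite big_ord_recr /= opprD addrA scalerBr opprB /u scalerA -rmorphM /=.
  by rewrite -exprMn divff // expr1n scale1r.
rewrite rnormN rnormZ ger0_norm ?exprn_ge0 //.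
apply: (le_trans (ler_wpM2l _ (sP n.+1))); first by rewrite exprn_ge0.
have -> : (8 : R) ^+ n * (1 / (1 - 8^-1) * 8^-1 ^+ n.+1) = 7^-1.
  rewrite exprS; have : (8 : R) ^+ n * 8^-1 ^+ n = 1.
    by rewrite -exprMn divff // expr1n.
  move: (8 ^+ n) (8^-1 ^+ n) => a b ab.
  have -> : a * (1 / (1 - 8^-1) * (8^-1 * b)) = a * b / 7 by field.
  by rewrite ab mul1r.
by lra.
Qed.

(** * Self-adjoint elements of a C*-algebra *)

Section CStarBasics.
Context {R : realType} {A : cstarAlgType R}.
Implicit Types a b c z : A.
Local Notation "a ** b" := (cmul a b) (at level 40, left associativity).

Lemma cmulNr a b : a ** (- b) = - (a ** b).
Proof. by rewrite -scaleN1r cmulZr scaleN1r. Qed.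

Lemma cmulNl a b : (- a) ** b = - (a ** b).
Proof. by rewrite -scaleN1r cmulZl scaleN1r. Qed.

Lemma cmulBr a b c : a ** (b - c) = a ** b - a ** c.
Proof. by rewrite cmulDr cmulNr. Qed.

Lemma cstarZr (t : R) a : cstar (t%:C *: a) = t%:C *: cstar a.
Proof. by rewrite cstarZ; congr (_ *: _); exact: conjc_real. Qed.

Lemma cstarN a : cstar (- a) = - cstar a.
Proof.
by rewrite -scaleN1r -(rmorphN1 (real_complex R)) cstarZr rmorphN1 scaleN1r.
Qed.

Lemma cstarZi a : cstar ('i *: a) = - ('i *: cstar a).
Proof.
rewrite cstarZ -scaleNr; congr (_ *: _).
by apply/eqP; rewrite eq_complex /= oppr0 !eqxx.
Qed.

Lemma rnormM a b : rnorm (a ** b) <= rnorm a * rnorm b.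
Proof. by rewrite -lecR rmorphM /= -!rnormE cnormM. Qed.

Lemma rnorm_cstar_mul a : rnorm (cstar a ** a) = rnorm a ^+ 2.
Proof. by apply: complexI; rewrite rmorphXn /= -!rnormE cnorm_star. Qed.

(** Both squares are [a^* a + b^* b]: the cross terms cancel. *)
Lemma rnorm_skew a b : cstar a ** b = cstar b ** a ->
  rnorm (a + 'i *: b) = rnorm (a - 'i *: b).
Proof.
move=> ab; apply/eqP; rewrite -(eqrXn2 (n := 2)) ?rnorm_ge0 //.
rewrite -!rnorm_cstar_mul !cstarD cstarN cstarZi opprK.
rewrite !cmulDl !cmulDr !cmulNl !cmulNr !cmulZl !cmulZr ab.
by rewrite !addrA subrK addrK.
Qed.

Lemma rnorm_addi_selfadjoint u z : cstar u = u ->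
  rnorm (z + 'i *: (u ** z)) = rnorm (z - 'i *: (u ** z)).
Proof. by move=> uu; apply: rnorm_skew; rewrite cstarM uu cmulA. Qed.

(** [2 z] is the sum of [z + iuz] and [z - iuz], which have the same norm. *)
Lemma le_rnorm_subi u z : cstar u = u -> rnorm z <= rnorm (z - 'i *: (u ** z)).
Proof.
move=> uu; have := rnormD (z + 'i *: (u ** z)) (z - 'i *: (u ** z)).
rewrite addrACA subrr addr0 rnorm_addi_selfadjoint // -mulr2n -scaler_nat.
by rewrite -(rmorph_nat (real_complex R)) rnormZ ger0_norm //; lra.
Qed.

(** The inequality [2|s| <= 1 + s^2] for operators: [4iuz] is the difference of
    [(1 + iu)^2 z] and [(1 - iu)^2 z], and both have the norm of
    [(1 + iu)(1 - iu) z = z + u^2 z]. *)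
Lemma rnorm_addsqr_ge u z : cstar u = u ->
  2 * rnorm (u ** z) <= rnorm (z + u ** (u ** z)).
Proof.
move=> uu; have ii : 'i * 'i = - 1 :> R[i] by rewrite -expr2 sqr_i.
pose a := z + 'i *: (u ** z); pose b := z - 'i *: (u ** z).
have ea : a - 'i *: (u ** a) = z + u ** (u ** z).
  rewrite /a cmulDr cmulZr scalerDr scalerA ii scaleN1r opprD opprK addrA.
  by rewrite addrK.
have eb : b + 'i *: (u ** b) = z + u ** (u ** z).
  rewrite /b cmulBr cmulZr scalerBr scalerA ii scaleN1r opprK addrA.
  by rewrite -(addrA z) (addrC (- _)) subrr addr0.
have na : rnorm (a + 'i *: (u ** a)) = rnorm (z + u ** (u ** z)).
  by rewrite rnorm_addi_selfadjoint // ea.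
have nb : rnorm (b - 'i *: (u ** b)) = rnorm (z + u ** (u ** z)).
  by rewrite -rnorm_addi_selfadjoint // eb.
have := rnormB (a + 'i *: (u ** a)) (b - 'i *: (u ** b)).
have -> : a + 'i *: (u ** a) - (b - 'i *: (u ** b)) =
    (4 : R)%:C *: ('i *: (u ** z)).
  have -> : (4 : R)%:C = 4 by rewrite rmorph_nat.
  rewrite /a /b cmulDr cmulBr scalerDr scalerBr !opprD !opprK.
  set x := 'i *: (u ** z); set y := 'i *: (u ** _).
  rewrite addrACA [z + x + _]addrACA [x + y + _]addrACA !subrr add0r addr0.
  by rewrite scaler_nat -!mulr2n -mulrnA.
by rewrite rnormZ rnormZi ger0_norm // na nb; lra.
Qed.

End CStarBasics.

(** * Accretive and positive elements *)

Section Accretive.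
Context {R : realType} {A : cstarAlgType R}.
Implicit Types a b c p q u z : A.
Local Notation "a ** b" := (cmul a b) (at level 40, left associativity).

(** Left multiplication by [b] is an accretive operator on [A]; for self-adjoint
    [b] this is a substitute for [b >= 0]. *)
Definition accretive (b : A) : Prop :=
  forall (t : R) z, 0 <= t -> rnorm z <= rnorm (z + t%:C *: (b ** z)).

(** The infinitesimal form of accretivity, convenient because it is additive
    in [b].  In one direction, [z] is replaced by [z - tbz]; in the other, the
    growth bound at small [t] is transported to an arbitrary [s] by
    convexity. *)
Lemma accretiveP b : accretive b <-> exists K : R, 0 <= K /\
  forall (t : R) z, 0 <= t ->
    rnorm (z - t%:C *: (b ** z)) <= (1 + K * t ^+ 2) * rnorm z.
Proof.
split=> [acc|[K [K0 bK]] s z s0].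
  exists (rnorm b ^+ 2); split=> [|t z t0];
    first by rewrite exprn_ge0 ?rnorm_ge0.
  apply: (le_trans (acc t _ t0)).
  rewrite cmulBr cmulZr scalerBr addrA subrK scalerA.
  apply: (le_trans (rnormB _ _));
    rewrite -rmorphM rnormZ -expr2 ger0_norm ?exprn_ge0 //.
  rewrite mulrDl mul1r lerD2l [leRHS]mulrAC [leRHS]mulrC ler_wpM2l
    ?exprn_ge0 //.
  apply: (le_trans (rnormM _ _)); rewrite expr2 -mulrA ler_wpM2l ?rnorm_ge0 //.
  exact: rnormM.
set w := z + _; apply/ler_addgt0Pr => e e0.
pose d := s * K * rnorm z + 1; pose t := e / d.
have d0 : 0 < d by rewrite ltr_wpDl // !mulr_ge0 ?rnorm_ge0.
have t0 : 0 < t by rewrite divr_gt0.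
have td : t * (s * K * rnorm z) <= e.
  by rewrite /t mulrAC ler_pdivrMr // ler_wpM2l ?(ltW e0) // /d lerDl.
(* dividing by t + s, z is a convex combination of z + sbz and z - tbz *)
have tz : (t + s)%:C *: z = t%:C *: w + s%:C *: (z - t%:C *: (b ** z)).
  rewrite /w scalerDr scalerBr !scalerA -!rmorphM (mulrC s t) addrACA subrr
    addr0.
  by rewrite -scalerDl -rmorphD.
have := rnormD (t%:C *: w) (s%:C *: (z - t%:C *: (b ** z))).
rewrite -tz !rnormZ !ger0_norm ?addr_ge0 // ?(ltW t0) // => h.
have := ler_wpM2l s0 (bK t z (ltW t0)) => h2.
rewrite -(ler_pM2l t0); nra.
Qed.

Lemma accretiveD b c : accretive b -> accretive c -> accretive (b + c).
Proof.
move=> /accretiveP[K [K0 bK]] /accretiveP[L [L0 cL]]; apply/accretiveP.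
exists (2 * (K + L)); split=> [|t z t0]; first by rewrite mulr_ge0 ?addr_ge0.
have t20 : 0 <= 2 * t by rewrite mulr_ge0.
(* the bound for b + c at t is the average of those for b and c at 2t *)
have h : (2 : R)%:C *: (z - t%:C *: ((b + c) ** z)) =
    (z - (2 * t)%:C *: (b ** z)) + (z - (2 * t)%:C *: (c ** z)).
  rewrite rmorphM /= rmorph_nat scalerBr scalerA cmulDl scalerDr addrACA.
  by rewrite -opprD scaler_nat mulr2n.
have := rnormD (z - (2 * t)%:C *: (b ** z)) (z - (2 * t)%:C *: (c ** z)).
rewrite -h rnormZ ger0_norm //.
by have := bK _ z t20; have := cL _ z t20; nra.
Qed.

Lemma accretiveZ (s : R) b : 0 <= s -> accretive b -> accretive (s%:C *: b).
Proof.
by move=> s0 acc t z t0; rewrite cmulZl scalerA -rmorphM acc // mulr_ge0.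
Qed.

(** With [v = sqrt(t) u], [z + t u^2 z = (1 + iv)(1 - iv) z], and neither factor
    decreases the norm. *)
Lemma accretive_sqr u : cstar u = u -> accretive (u ** u).
Proof.
move=> uu t z t0; pose v := (Num.sqrt t)%:C *: u.
have vv : cstar v = v by rewrite cstarZr uu.
apply: (le_trans (le_rnorm_subi z vv)).
apply: (le_trans (le_rnorm_subi _ vv)); rewrite -rnorm_addi_selfadjoint //.
rewrite cmulBr cmulZr scalerBr scalerA -expr2 sqr_i scaleN1r opprK addrA subrK.
by rewrite /v !cmulZl cmulZr scalerA -rmorphM -expr2 sqr_sqrtr // cmulA.
Qed.

Section Commutative.
Hypothesis A_comm : commutative (@cmul R A).

(** [a^* a] is the sum of the squares of the real and imaginary parts of [a],
    which commute. *)
Lemma accretive_positive a : accretive (cstar a ** a).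
Proof.
pose h : R[i] := (2^-1 : R)%:C.
pose u := h *: (a + cstar a); pose v := ('i * h) *: (cstar a - a).
have uu : cstar u = u by rewrite cstarZr cstarD cstarK addrC.
have vv : cstar v = v.
  rewrite /v -scalerA cstarZi cstarZr cstarD cstarN cstarK -scalerN -scalerN.
  by rewrite opprB.
have -> : cstar a ** a = u ** u + v ** v.
  have ihih : ('i * h) * ('i * h) = - (h * h).
    by rewrite mulrACA -expr2 sqr_i mulN1r.
  rewrite /u /v !(cmulZl, cmulZr) !scalerA ihih scaleNr -scalerBr.
  rewrite !(cmulDl, cmulDr, cmulNl, cmulNr) (A_comm a (cstar a)).
  set x := a ** a; set y := cstar a ** a; set w := cstar a ** cstar a.
  have -> : x + y + (y + w) - (w - y - (y - x)) = 4%:R *: y.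
    rewrite (addrC x y) addrACA (opprB y x) [w - y + _]addrACA -opprD.
    rewrite (addrC w x) opprB [LHS]addrACA subrr addr0.
    by rewrite scaler_nat -!mulr2n -mulrnA.
  rewrite scalerA -(rmorph_nat (real_complex R)) -!rmorphM /=.
  by rewrite (_ : _ * _ = 1) ?scale1r //; field.
by apply: accretiveD; apply: accretive_sqr.
Qed.

(** Monotonicity of the norm on positive elements.  With [|p| = 1] and
    [|p + q| < 1], accretivity of [q] makes [1 - p] bounded below; the vectors
    [w = (1 + p) z k] of the proof contradict this, since [(1 - p) w] stays
    bounded by telescoping while [|w|] grows like [2^k]. *)
Lemma le_rnorm_accretiveD p q : cstar p = p -> accretive p -> accretive q ->
  rnorm p <= rnorm (p + q).
Proof.
move=> pp accp accq; rewrite leNgt; apply/negP => pq.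
wlog p1 : p q pp accp accq pq / rnorm p = 1 => [wl|].
  have p0 : 0 < rnorm p by apply: le_lt_trans pq; exact: rnorm_ge0.
  pose s := (rnorm p)^-1; have s0 : 0 <= s by rewrite invr_ge0 rnorm_ge0.
  have sp1 : rnorm (s%:C *: p) = 1 by rewrite rnormZ ger0_norm // mulVf ?gt_eqF.
  apply: (wl (s%:C *: p) (s%:C *: q)) => //; try exact: accretiveZ.
    by rewrite cstarZr pp.
  by rewrite sp1 -scalerDr rnormZ ger0_norm // mulrC ltr_pdivrMr // mul1r.
rewrite p1 in pq.
(* e k = p^(2^k) and z k = (1 + p^2)(1 + p^4)...(1 + p^(2^k)) p *)
pose fix e k := if k is j.+1 then e j ** e j else p.
pose fix z k := if k is j.+1 then z j + e j ** (e j ** z j) else p.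
have es k : cstar (e k) = e k by elim: k => //= k IH; rewrite cstarM IH.
have e1 k : rnorm (e k) = 1.
  elim: k => //= k IH; by rewrite -{1}(es k) rnorm_cstar_mul IH expr1n.
(* each factor 1 + p^(2^(j+1)) gains 2 p^(2^j), by rnorm_addsqr_ge; these powers
   and the last factor p multiply up to p^(2^k) *)
have zlow y k : 2 ^+ k * rnorm (y ** e k) <= rnorm (y ** z k).
  elim: k y => [|k IH] y; first by rewrite mul1r.
  have -> : y ** z k.+1 = y ** z k + e k ** (e k ** (y ** z k)).
    rewrite /= cmulDr; congr (_ + _); rewrite !cmulA; congr (_ ** _).
    by rewrite -cmulA A_comm.
  apply: le_trans (rnorm_addsqr_ge _ (es k)).
  rewrite exprS -mulrA ler_wpM2l // cmulA; apply: le_trans (IH _).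
  by rewrite /= (A_comm (e k) y) cmulA.
have zbig k : 2 ^+ k <= rnorm (z k).
  have := zlow (e k) k; rewrite -[e k ** e k]/(e k.+1) e1 mulr1.
  move=> /le_trans; apply.
  by apply: (le_trans (rnormM _ _)); rewrite e1 mul1r.
have tele k : z k - p ** (p ** z k) = p - e k ** (e k ** p).
  elim: k => //= k IH.
  have -> : p ** (p ** (z k + e k ** (e k ** z k))) =
      p ** (p ** z k) + e k ** (e k ** (p ** (p ** z k))).
    rewrite !cmulDr; congr (_ + _); rewrite !cmulA; congr (_ ** _).
    by rewrite -cmulA A_comm -!cmulA.
  by rewrite opprD addrACA -!cmulBr IH !cmulBr addrA subrK !cmulA.
have zsmall k : rnorm (z k - p ** (p ** z k)) <= 2.
  rewrite tele; apply: (le_trans (rnormB _ _)).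
  have := rnormM (e k) (e k ** p); have := rnormM (e k) p; rewrite p1 e1; lra.
have main k : (1 - rnorm (p + q)) * 2 ^+ k <= 2.
  pose w := z k + p ** z k.
  have zw : rnorm (z k) <= rnorm w.
    by have := accp 1 (z k) ler01; rewrite scale1r.
  have := accq 1 w ler01; rewrite scale1r.
  have -> : w + q ** w = (z k - p ** (p ** z k)) + (p + q) ** w.
    rewrite cmulDl addrA; congr (_ + _); rewrite /w cmulDr !addrA.
    by rewrite [RHS]addrAC subrK.
  move=> /le_trans/(_ (rnormD _ _)).
  have wbig := le_trans (zbig k) zw; have d0 : 0 <= 1 - rnorm (p + q) by lra.
  have := rnormM (p + q) w; have := zsmall k; have := ler_wpM2l d0 wbig.
  by lra.
have d0 : 0 < 1 - rnorm (p + q) by rewrite subr_gt0.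
have [|n] := @geometric_small R 2 2^-1 _ _ d0; first by lra.
rewrite exprVn ltr_pdivrMr ?exprn_gt0 //.
by rewrite ltNge main.
Qed.

End Commutative.
End Accretive.

(** * Inner products and norms in a Hilbert module *)

Section HilbertModuleBasics.
Context {R : realType} {A : cstarAlgType R} {E : hilbertModType A}.
Implicit Types (x y z : E) (a b : A).
Local Notation "a ** b" := (cmul a b) (at level 40, left associativity).

Lemma inner_norm2 x : rnorm (inner x x) = rnorm x ^+ 2.
Proof.
by apply: complexI; rewrite rmorphXn /= -!rnormE (inner_norm x) sqrtCK.
Qed.

Lemma innerDl x y z : inner (x + y) z = inner x z + inner y z.
Proof. by rewrite -inner_star innerDr cstarD !inner_star. Qed.

Lemma inner0r x : inner x 0 = 0.
Proof. by rewrite -[X in inner _ X](scale0r (0 : E)) innerZr scale0r. Qed.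

Lemma innerNr x y : inner x (- y) = - inner x y.
Proof. by rewrite -scaleN1r innerZr scaleN1r. Qed.

Lemma innerNl x y : inner (- x) y = - inner x y.
Proof. by rewrite -inner_star innerNr cstarN inner_star. Qed.

Lemma innerZl (t : R) x y : inner (t%:C *: x) y = t%:C *: inner x y.
Proof. by rewrite -inner_star innerZr cstarZr inner_star. Qed.

Lemma inner_ractl x y a : inner (ract x a) y = cstar a ** inner x y.
Proof. by rewrite -inner_star inner_ract cstarM inner_star. Qed.

Lemma inner_inj x y : (forall z, inner x z = inner y z) -> x = y.
Proof.
move=> xy; apply/eqP; rewrite -subr_eq0; apply/eqP/rnorm_eq0.
apply/eqP; rewrite -sqrf_eq0 -inner_norm2 innerDl innerNl xy subrr.
by rewrite rnorm0 eqxx.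
Qed.

Lemma ract0r x : ract x 0 = 0.
Proof. by rewrite -[X in ract _ X](scale0r (0 : A)) ractZr scale0r. Qed.

Lemma ractBl x y a : ract (x - y) a = ract x a - ract y a.
Proof. by rewrite ractDl -scaleN1r ractZl scaleN1r. Qed.

Lemma rnorm_cstar a : rnorm (cstar a) = rnorm a.
Proof.
suff le b : rnorm b <= rnorm (cstar b).
  by apply/eqP; rewrite eq_le le -{2}[a]cstarK le.
have := rnorm_ge0 b; rewrite le_eqVlt => /predU1P[<-|b0];
  first exact: rnorm_ge0.
by rewrite -(ler_pM2r b0) -expr2 -rnorm_cstar_mul rnormM.
Qed.

Lemma rnorm_ract x a : rnorm (ract x a) <= rnorm x * rnorm a.
Proof.
rewrite -(ler_pXn2r (n := 2)) ?nnegrE ?mulr_ge0 ?rnorm_ge0 //.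
rewrite -inner_norm2 inner_ract inner_ractl exprMn -inner_norm2.
apply: (le_trans (rnormM _ _)); rewrite expr2 mulrA ler_wpM2r ?rnorm_ge0 //.
by apply: (le_trans (rnormM _ _)); rewrite rnorm_cstar mulrC.
Qed.

(** A crude Cauchy-Schwarz inequality.  Polarization and the triangle inequality
    of the norm of [E] bound first the symmetric part of the inner product, then
    the inner product itself; rescaling gives the product form. *)
Lemma rnorm_inner x y : rnorm (inner x y) <= 4 * (rnorm x * rnorm y).
Proof.
have sym (u v : E) : rnorm (inner u v + inner v u) <= (rnorm u + rnorm v) ^+ 2.
  have h : (2 : R)%:C *: (inner u v + inner v u) =
      inner (u + v) (u + v) - inner (u - v) (u - v).
    rewrite !(innerDl, innerDr, innerNl, innerNr).
    set a := inner u u; set b := inner v v; set c := inner u v;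
      set d := inner v u.
    rewrite (addrC d b) addrACA (opprB d b) [a - c + _]addrACA.
    rewrite -opprD opprB (addrC (a + b)) [RHS]addrACA subrr addr0.
    by rewrite rmorph_nat scaler_nat.
  have : 2 * rnorm (inner u v + inner v u) <=
      rnorm (u + v) ^+ 2 + rnorm (u - v) ^+ 2.
    rewrite -!inner_norm2 -[2 in leLHS]ger0_norm // -rnormZ h; exact: rnormB.
  have := rnormD u v; have := rnormB u v.
  have := rnorm_ge0 (u + v); have := rnorm_ge0 (u - v).
  move: (rnorm u + rnorm v) => s s1 s2 s3 s4.
  have := lerXn2r 2 _ _ s3; have := lerXn2r 2 _ _ s4.
  rewrite !nnegrE s1 s2 (le_trans s1 s3) => /(_ isT isT) + /(_ isT isT).
  by lra.
have dom (u v : E) : rnorm (inner u v) <= (rnorm u + rnorm v) ^+ 2.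
  have h : (2 : R)%:C *: inner u v =
      (inner u v + inner v u) - 'i *: (inner u ('i *: v) + inner ('i *: v) u).
    rewrite -(inner_star u ('i *: v)) !innerZr cstarZi inner_star.
    rewrite scalerBr !scalerA -expr2 sqr_i !scaleN1r opprB opprK.
    by rewrite addrA addrK rmorph_nat scaler_nat.
  have := sym u v; have := sym u ('i *: v); rewrite rnormZi => h1 h2.
  have := rnormB (inner u v + inner v u)
    ('i *: (inner u ('i *: v) + inner ('i *: v) u)).
  by rewrite -h rnormZ rnormZi ger0_norm //; lra.
have := rnorm_ge0 x; rewrite le_eqVlt => /predU1P[/esym/rnorm_eq0 ->|x0].
  by rewrite -rnorm_cstar inner_star inner0r !rnorm0 mul0r mulr0.
have := rnorm_ge0 y; rewrite le_eqVlt => /predU1P[/esym/rnorm_eq0 ->|y0].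
  by rewrite inner0r !rnorm0 !mulr0.
(* |y|x and |x|y have the same norm, so that dom loses no more than the factor 4 *)
have := dom ((rnorm y)%:C *: x) ((rnorm x)%:C *: y).
rewrite innerZl innerZr !rnormZ !gtr0_norm // => h.
have xy0 : 0 < rnorm x * rnorm y by rewrite mulr_gt0.
by rewrite -(ler_pM2l xy0); move: h; nra.
Qed.

End HilbertModuleBasics.

(** * Generators in a dense subset *)

Section Generation.
Context {R : realType} {A : cstarAlgType R} {E : hilbertModType A}.

Definition combination N (f : 'I_N -> E) (phi : 'I_N -> A) : E :=
  \sum_(j < N) ract (f j) (phi j).

Definition size_family N (phi : 'I_N -> A) : R := \sum_(j < N) rnorm (phi j).

Lemma rnorm_combination N (f : 'I_N -> E) phi (e : R) :
  (forall j, rnorm (f j) <= e) ->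
  rnorm (combination f phi) <= e * size_family phi.
Proof.
move=> fe; apply: (le_trans (rnorm_sum _ _)); rewrite mulr_sumr;
  apply: ler_sum => j _.
by apply: (le_trans (rnorm_ract _ _)); rewrite ler_wpM2r ?rnorm_ge0.
Qed.

Lemma combinationD N (f : 'I_N -> E) phi psi :
  combination f (fun j => phi j + psi j) =
    combination f phi + combination f psi.
Proof. by rewrite -big_split; apply: eq_bigr => j _; rewrite ractDr. Qed.

Lemma size_familyD N (phi psi : 'I_N -> A) :
  size_family (fun j => phi j + psi j) <= size_family phi + size_family psi.
Proof. by rewrite -big_split; apply: ler_sum => j _; exact: rnormD. Qed.

Lemma combinationZ N (f : 'I_N -> E) (t : R) phi :
  combination f (fun j => t%:C *: phi j) = t%:C *: combination f phi.
Proof. by rewrite scaler_sumr; apply: eq_bigr => j _; rewrite ractZr. Qed.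

Lemma size_familyZ N (t : R) (phi : 'I_N -> A) :
  size_family (fun j => t%:C *: phi j) = `|t| * size_family phi.
Proof. by rewrite mulr_sumr; apply: eq_bigr => j _; rewrite rnormZ. Qed.

Lemma finitely_generated_approx : finitely_generated E ->
  exists N (f : 'I_N -> E) (c : R), 0 <= c /\ forall x, exists2 phi,
    size_family phi <= c * rnorm x &
    rnorm (x - combination f phi) <= 4^-1 * rnorm x.
Proof.
move=> [N [f fgen]]; exists N, f.
pose P c x := exists2 phi, size_family phi <= c & x = combination f phi.
have [] := @cover_approximation R E P.
- by move=> c d x cd [phi hc hx]; exists phi => //; apply: le_trans cd.
- move=> c d x y [phi hc ->] [psi hd ->]; exists (fun j => phi j + psi j).
    by apply: (le_trans (size_familyD _ _)); rewrite lerD.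
  by rewrite combinationD.
- move=> c t x [phi hc ->]; exists (fun j => t%:C *: phi j).
    by rewrite size_familyZ ler_wpM2l.
  by rewrite combinationZ.
- by move=> x; have [phi xphi] := fgen x; exists (size_family phi), phi.
move=> c cP; have c0 : 0 <= c.
  have [|_ [phi phic _] _] := cP 0; first by rewrite rnorm0.
  by apply: le_trans phic; apply: sumr_ge0 => j _; exact: rnorm_ge0.
exists c; split=> // x.
have := rnorm_ge0 x; rewrite le_eqVlt => /predU1P[/esym/rnorm_eq0 ->|x0].
  exists (fun=> 0); rewrite rnorm0 mulr0.
    by rewrite /size_family big1 // => j _; rewrite rnorm0.
  by rewrite /combination big1 ?subrr ?rnorm0 // => j _; rewrite ract0r.
have [|_ [phi phic ->] xphi] := cP ((rnorm x)^-1%:C *: x).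
  by rewrite rnormZ ger0_norm ?invr_ge0 ?rnorm_ge0 // mulVf ?gt_eqF.
exists (fun j => (rnorm x)%:C *: phi j).
  by rewrite size_familyZ gtr0_norm // mulrC ler_wpM2r ?rnorm_ge0.
have -> : x - combination f (fun j => (rnorm x)%:C *: phi j) =
    (rnorm x)%:C *: ((rnorm x)^-1%:C *: x - combination f phi).
  by rewrite combinationZ scalerBr scalerA -rmorphM mulfV ?gt_eqF // rmorph1
    scale1r.
by rewrite rnormZ gtr0_norm // mulrC ler_wpM2r ?rnorm_ge0.
Qed.

(** Successive approximation: solve up to half the norm, then solve for the
    residual, and sum the coefficients. *)
Lemma combination_exact N (g : 'I_N -> E) (c : R) : 0 <= c ->
  (forall x, exists2 phi, size_family phi <= c * rnorm x &
     rnorm (x - combination g phi) <= 2^-1 * rnorm x) ->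
  exists K, forall x, exists2 phi, size_family phi <= K * rnorm x &
    x = combination g phi.
Proof.
move=> c0 gc.
have /choice[Phi PhiP] : forall x, exists phi : 'I_N -> A,
    size_family phi <= c * rnorm x /\
    rnorm (x - combination g phi) <= 2^-1 * rnorm x.
  by move=> x; have [phi] := gc x; exists phi.
exists (N%:R * (2 * c)) => x.
pose fix r k := if k is j.+1 then r j - combination g (Phi (r j)) else x.
have rP k : rnorm (r k) <= rnorm x * 2^-1 ^+ k.
  elim: k => [|k IH]; first by rewrite mulr1.
  by apply: (le_trans (PhiP _).2); rewrite exprS mulrCA ler_wpM2l ?invr_ge0.
have half : 0 <= (2^-1 : R) < 1 by apply/andP; split; lra.
have compP j k : rnorm (Phi (r k) j) <= (c * rnorm x) * 2^-1 ^+ k.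
  apply: le_trans (le_trans (PhiP (r k)).1 _); last by rewrite -mulrA ler_wpM2l.
  by rewrite /size_family (bigD1 j) //= lerDl sumr_ge0 // => i _;
    exact: rnorm_ge0.
have /choice[phi phiP] : forall j, exists s, forall n,
    rnorm (s - \sum_(k < n) Phi (r k) j) <=
    (c * rnorm x) / (1 - 2^-1) * 2^-1 ^+ n.
  by move=> j; exact: geometric_series_cvg half (compP j).
have e2 : (1 - 2^-1 : R) = 2^-1 by lra.
exists phi.
  have -> : N%:R * (2 * c) * rnorm x = \sum_(j < N) (2 * c * rnorm x).
    by rewrite sumr_const card_ord -[RHS]mulr_natl !mulrA.
  apply: ler_sum => j _.
  by have := phiP j 0; rewrite big_ord0 subr0 mulr1 e2 invrK; lra.
have partial n : x - r n = combination g (fun j => \sum_(k < n) Phi (r k) j).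
  elim: n => [|n IH].
    by rewrite subrr /combination big1 // => j _; rewrite big_ord0 ract0r.
  rewrite /= opprB addrCA IH addrC -combinationD; congr combination.
  by apply/funext => j; rewrite big_ord_recr.
apply/eqP; rewrite -subr_eq0; apply/eqP.
pose M := \sum_(j < N) rnorm (g j).
apply: (@rnorm_small0 R E _
  (rnorm x + M * (N%:R * (c * rnorm x / (1 - 2^-1)))) 2^-1) => // n.
have -> : x - combination g phi =
    r n - combination g (fun j => phi j - \sum_(k < n) Phi (r k) j).
  have -> : combination g phi =
      (x - r n) + combination g (fun j => phi j - \sum_(k < n) Phi (r k) j).
    rewrite partial -combinationD; congr combination; apply/funext => j.
    by rewrite addrC subrK.
  by rewrite opprD opprB addrA (addrC x) subrK.
apply: (le_trans (rnormB _ _)); rewrite mulrDl lerD //.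
have gM j : rnorm (g j) <= M.
  by rewrite /M (bigD1 j) //= lerDl sumr_ge0 // => i _; exact: rnorm_ge0.
apply: (le_trans (rnorm_combination _ gM)).
rewrite -mulrA ler_wpM2l //; first by apply: sumr_ge0 => j _; exact: rnorm_ge0.
have -> : N%:R * (c * rnorm x / (1 - 2^-1)) * 2^-1 ^+ n =
    \sum_(j < N) (c * rnorm x / (1 - 2^-1) * 2^-1 ^+ n).
  by rewrite sumr_const card_ord -[RHS]mulr_natl !mulrA.
by apply: ler_sum => j _; exact: phiP.
Qed.

(** Moving each generator by at most [e] changes a combination of size
    [c|x|] by at most [e c |x|], so approximate solvability persists. *)
Lemma dense_generators (D : set E) : finitely_generated E ->
  dense D ->
  exists N (g : 'I_N -> E) (K : R), (forall j, D (g j)) /\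
    forall x, exists2 phi, size_family phi <= K * rnorm x &
      x = combination g phi.
Proof.
move=> /finitely_generated_approx[N [f [c [c0 fc]]]] /dense_approx Dd.
pose e : R := (4 * (c + 1))^-1.
have e0 : 0 < e by rewrite invr_gt0 mulr_gt0 // ltr_wpDl.
have ec : e * c <= 4^-1.
  rewrite /e invfM -mulrA ler_piMr // ?invr_ge0 // mulrC.
  by rewrite ler_pdivrMr ?ltr_wpDl // mul1r lerDl.
have /choice[g gP] : forall j, exists y, D y /\ rnorm (f j - y) < e.
  by move=> j; have [y Dy fy] := Dd (f j) e e0; exists y.
have [x|K gK] := @combination_exact N g c c0.
  have [phi phic fphi] := fc x; exists phi => //.
  have -> : x - combination g phi = (x - combination f phi) +
      combination (fun j => f j - g j) phi.
    have -> : combination (fun j => f j - g j) phi =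
        combination f phi - combination g phi.
      by rewrite /combination -sumrB; apply: eq_bigr => j _; rewrite ractBl.
    by rewrite addrA subrK.
  apply: (le_trans (rnormD _ _)).
  have h : rnorm (combination (fun j => f j - g j) phi) <= e * size_family phi.
    by apply: rnorm_combination => j; exact: ltW (gP j).2.
  have := ler_wpM2l (ltW e0) phic; have := ler_wpM2r (rnorm_ge0 x) ec.
  by lra.
by exists N, g, K; split=> // j; exact: (gP j).1.
Qed.

End Generation.

(** * The method of continuity *)

Section ContinuityMethod.
Context {R : realType} {V : normedModType R[i]}.

(** Approximating the residual again and again divides it by two each time. *)
Lemma half_residual_dense (D : set V) :
  (forall x y, D x -> D y -> D (x + y)) ->
  (forall w, exists2 v, D v & rnorm (w - v) <= 2^-1 * rnorm w) -> dense D.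
Proof.
move=> DD Dhalf; apply/dense_approx => x e e0.
have [v0 Dv0 _] := Dhalf x.
have h n : exists2 v, D v & rnorm (x - v) <= rnorm (x - v0) * 2^-1 ^+ n.
  elim: n => [|n [v Dv vn]]; first by exists v0; rewrite ?mulr1.
  have [u Du un] := Dhalf (x - v); exists (v + u); first exact: DD.
  rewrite opprD addrA; apply: (le_trans un).
  by rewrite exprS mulrCA ler_wpM2l // invr_ge0.
have half : 0 <= (2^-1 : R) < 1 by apply/andP; split; lra.
have [n ne] := @geometric_small R (rnorm (x - v0)) 2^-1 e half e0.
by have [v Dv vn] := h n; exists v => //; exact: le_lt_trans ne.
Qed.

(** With [h = 1/n] small, density of the range passes from [1 + kh S] to
    [1 + (k+1)h S]: the uniform lower bound controls the solution of the former
    equation, so the extra term [h S x] is a small error.  After [n] steps the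
    parameter reaches 1. *)
Lemma continuity_method (S : V -> V) (M c : R) :
  {morph S : x y / x + y} -> 0 <= M -> (forall x, rnorm (S x) <= M * rnorm x) ->
  0 <= c -> (forall t x, 0 <= t -> rnorm x <= c * rnorm (x + t%:C *: S x)) ->
  dense (range (fun x => x + S x)).
Proof.
move=> SD M0 SM c0 lowS.
pose n := (Num.truncn (8 * (M * c))).+1.
have n0 : (0 : R) < n%:R by rewrite ltr0n.
pose h : R := n%:R^-1; have h0 : 0 <= h by rewrite invr_ge0 ltW.
have hMc : h * (M * c) <= 8^-1.
  rewrite /h mulrC ler_pdivrMr //.
  by have := ltW (truncnS_gt (8 * (M * c))); rewrite -/n; lra.
have rangeD t : forall u v : V, range (fun x => x + t%:C *: S x) u ->
    range (fun x => x + t%:C *: S x) v ->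
    range (fun x => x + t%:C *: S x) (u + v).
  move=> _ _ [x _ <-] [y _ <-]; exists (x + y) => //.
  by rewrite SD scalerDr addrACA.
have step k : dense (range (fun x => x + (k%:R * h)%:C *: S x)).
  elim: k => [|k IH].
    apply/dense_approx => x e e0; exists x; last by rewrite subrr rnorm0.
    by exists x => //; rewrite mul0r scale0r addr0.
  apply: half_residual_dense => [u v|w]; first exact: rangeD.
  have := rnorm_ge0 w; rewrite le_eqVlt => /predU1P[/esym/rnorm_eq0 ->|w0].
    exists 0; last by rewrite subrr rnorm0 mulr0.
    exists 0 => //; have S0 : S 0 = 0.
      by apply: (addrI (S 0)); rewrite -SD !addr0.
    by rewrite S0 scaler0 addr0.
  have w4 : 0 < 4^-1 * (rnorm w) by rewrite mulr_gt0 // invr_gt0.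
  have := (dense_approx _).1 IH w _ w4 => -[_ [x _ <-] xw].
  set y := x + _ in xw.
  exists (x + (k.+1%:R * h)%:C *: S x); first by exists x.
  have -> : w - (x + (k.+1%:R * h)%:C *: S x) = (w - y) - h%:C *: S x.
    rewrite -addn1 natrD mulrDl mul1r rmorphD scalerDl /y.
    by rewrite addrA opprD addrA.
  have yw : rnorm y <= 2 * rnorm w.
    have -> : y = w - (w - y) by rewrite opprB addrC subrK.
    by apply: (le_trans (rnormB _ _)); lra.
  have xy : rnorm x <= c * rnorm y by apply: lowS; rewrite mulr_ge0.
  apply: (le_trans (rnormB _ _)); rewrite rnormZ ger0_norm //.
  have a1 : h * rnorm (S x) <= h * (M * (c * rnorm y)).
    by rewrite ler_wpM2l // (le_trans (SM _)) // ler_wpM2l.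
  have a2 : h * (M * (c * rnorm y)) <= 8^-1 * (2 * rnorm w).
    rewrite (mulrA M) mulrA; apply: ler_pM => //.
    + by rewrite !mulr_ge0.
    + exact: rnorm_ge0.
  by lra.
by have := step n; rewrite /h mulfV ?gt_eqF //;
  under eq_fun do rewrite rmorph1 scale1r.
Qed.

End ContinuityMethod.

(** * Operators with an adjoint *)

Section AdjointableOperators.
Context {R : realType} {A : cstarAlgType R} {E : hilbertModType A}.

Definition adjoint_pair (S S' : E -> E) : Prop :=
  forall x y, inner (S x) y = inner x (S' y).

Lemma adjoint_pair_sym (S S' : E -> E) : adjoint_pair S S' -> adjoint_pair S' S.
Proof. by move=> SS' x y; rewrite -inner_star -SS' inner_star. Qed.

Lemma adjoint_pairD (S S' : E -> E) : adjoint_pair S S' ->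
  {morph S : x y / x + y}.
Proof. by move=> SS' x y; apply: inner_inj => z; rewrite SS' !innerDl !SS'. Qed.

Lemma adjoint_pair_ract (S S' : E -> E) x a : adjoint_pair S S' ->
  S (ract x a) = ract (S x) a.
Proof. by move=> SS'; apply: inner_inj => z; rewrite SS' !inner_ractl SS'. Qed.

Lemma adjoint_pair_combination (S S' : E -> E) N (g : 'I_N -> E) phi :
  adjoint_pair S S' ->
  S (combination g phi) = combination (S \o g) phi.
Proof.
move=> SS'; have SD := adjoint_pairD SS'.
have S0 : S 0 = 0 by apply: (addrI (S 0)); rewrite -SD !addr0.
rewrite /combination (big_morph S SD S0).
by apply: eq_bigr => j _; rewrite (adjoint_pair_ract _ _ SS').
Qed.

(** The value at [x] is the combination of the values at the generators with the
    coefficients of [x], and these are bounded by a multiple of [|x|]. *)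
Lemma adjoint_pair_bounded (S S' : E -> E) : finitely_generated E ->
  adjoint_pair S S' ->
  exists M, 0 <= M /\ forall x, rnorm (S x) <= M * rnorm x.
Proof.
move=> fgE SS'.
have [|N [g [K [_ gK]]]] := @dense_generators _ _ _ setT fgE.
  by apply/dense_approx => x e e0; exists x; rewrite ?subrr ?rnorm0.
pose M := \sum_(j < N) rnorm (S (g j)).
have M0 : 0 <= M by apply: sumr_ge0 => j _; exact: rnorm_ge0.
have gM j : rnorm ((S \o g) j) <= M.
  by rewrite /M (bigD1 j) //= lerDl sumr_ge0 // => i _; exact: rnorm_ge0.
exists (M * `|K|); split=> [|x]; first by rewrite mulr_ge0.
have [phi phiK {1}->] := gK x.
rewrite (adjoint_pair_combination _ _ SS') -mulrA.
apply: (le_trans (rnorm_combination _ gM)); rewrite ler_wpM2l //.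
by apply: (le_trans phiK); rewrite ler_wpM2r ?rnorm_ge0 // ler_norm.
Qed.

(** [<x, x + tS'Sx> = <x,x> + t<Sx,Sx>] is a sum of positive elements, so its
    norm is at least [|x|^2]. *)
Lemma adjoint_pair_lower_bound (A_comm : commutative (@cmul R A))
    (S S' : E -> E) (t : R) x :
  adjoint_pair S S' -> 0 <= t -> rnorm x <= 4 * rnorm (x + t%:C *: S' (S x)).
Proof.
move=> SS' t0; set y := x + _.
have := rnorm_ge0 x; rewrite le_eqVlt => /predU1P[<-|x0].
  by rewrite mulr_ge0 ?rnorm_ge0.
have inner_acc (z : E) : accretive (inner z z).
  by have [b ->] := inner_pos z; exact: accretive_positive.
have : rnorm (inner x x) <= rnorm (inner x y).
  rewrite /y innerDr innerZr -SS'; apply: (le_rnorm_accretiveD A_comm) => //.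
  - by rewrite inner_star.
  - exact: accretiveZ.
rewrite inner_norm2 => /le_trans/(_ (rnorm_inner _ _)).
by rewrite expr2 mulrCA ler_pM2l.
Qed.

Lemma adjoint_pair_dense_range (A_comm : commutative (@cmul R A)) (S S' : E -> E) :
  finitely_generated E -> adjoint_pair S S' ->
  dense (range (fun x => x + S' (S x))).
Proof.
move=> fgE SS'; have S'S := adjoint_pair_sym SS'.
have [M [M0 SM]] := adjoint_pair_bounded fgE SS'.
have [L [L0 SL]] := adjoint_pair_bounded fgE S'S.
apply: (@continuity_method _ _ _ (L * M) 4) => //.
- by move=> x y; rewrite (adjoint_pairD SS') (adjoint_pairD S'S).
- by rewrite mulr_ge0.
- by move=> x; rewrite -mulrA (le_trans (SL _)) // ler_wpM2l.
- by move=> t x; exact: (adjoint_pair_lower_bound A_comm _ SS').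
Qed.

(** The dense set contains generators of [E]; being a submodule, it contains
    their combinations. *)
Lemma dense_submodule_full (D : set E) : finitely_generated E ->
  is_submodule D -> dense D -> D = setT.
Proof.
move=> fgE [D0 DD _ Dract] Dd; apply/seteqP; split=> // x _.
have [N [g [K [Dg gK]]]] := dense_generators fgE Dd.
have [phi _ ->] := gK x.
by apply: (big_ind D) => // j _; exact: Dract.
Qed.

Lemma adjoint_submodule (T : operator E) : is_submodule (opdom (adjoint T)).
Proof.
split.
- by exists 0 => x _; rewrite !inner0r.
- move=> y y' [z yz] [z' yz']; exists (z + z') => x Tx.
  by rewrite !innerDr yz // yz'.
- by move=> l y [z yz]; exists (l *: z) => x Tx; rewrite !innerZr yz.
- by move=> y a [z yz]; exists (ract z a) => x Tx; rewrite !inner_ract yz.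
Qed.

Lemma semiregular_adjoint_pair (T : operator E) : finitely_generated E ->
  semiregular T -> [/\ opdom T = setT, opdom (adjoint T) = setT
    & adjoint_pair T (adjoint T)].
Proof.
move=> fgE [Tsub Td T'd].
have Tfull := dense_submodule_full fgE Tsub Td.
have T'full := dense_submodule_full fgE (adjoint_submodule T) T'd.
split=> // x y.
have [z yz] : opdom (adjoint T) y by rewrite T'full.
have /(_ x) : adjoint_rel T y (adjoint T y) := xgetPex 0 (ex_intro _ z yz).
by apply; rewrite Tfull.
Qed.

End AdjointableOperators.

Theorem theorem5p9 (R : realType) (A : cstarAlgType R) (E : hilbertModType A)
  (A_comm : commutative (@cmul R A)) (E_fg : finitely_generated E)
  (T : operator E) (T_semiregular : semiregular T) (T_closed : closed_operator T) :
  regular T.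
Proof.
have [Tfull T'full TT'] := semiregular_adjoint_pair E_fg T_semiregular.
split=> //; have -> : opdom (id_plus_adjoint_comp T) = setT.
  apply/seteqP; split=> // x _.
  by change (opdom T x /\ opdom (adjoint T) (T x)); rewrite Tfull T'full.
exact: (adjoint_pair_dense_range A_comm E_fg TT').
Qed.
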